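(* Let $m\ge1$. The linear operator $\mathcal R^m:V_h\to\mathcal V_h^m$ is non-degenerate (i.e. $\mathcal R^mv_h=0$ implies $v_h=0$ for $v_h\in V_h$), and $\dim(\mathcal V_h^m)=\dim(V_h)$.
   Context: Mesh. $\Omega\subset\mathbb R^d$ ($d=2,3$) is a bounded convex polygonal (polyhedral) domain and $\mathcal T_h$ is a quasi-uniform triangulation of $\Omega$ into triangles (tetrahedra). $\mathcal N_h$ is the set of mesh nodes (vertices); $\mathcal N_K$ is the set of vertices of $K\in\mathcal T_h$. Patches. $w(K)=\{K'\in\mathcal T_h:\overline K\cap\overline{K'}\ne\varnothing\}$, $\mathcal S_0(K)=\{K\}$, $\mathcal S_{t+1}(K)=\bigcup_{K'\in\mathcal S_t(K)}w(K')$, $\mathcal I_t(K)=\bigcup_{K'\in\mathcal S_t(K)}\mathcal N_{K'}$. Given a fixed threshold $N_m>d+1$, let $t_K\ge 1$ be the smallest integer with $\#\mathcal I_{t_K}(K)\ge N_m$. The patch $\mathcal S(K)$ consists of $\mathcal S_{t_K-1}(K)$ together with elements of $\mathcal S_{t_K}(K)\setminus\mathcal S_{t_K-1}(K)$ added one at a time in order of increasing distance (between barycenters) to $K$, until $\mathcal I(K):=\bigcup_{K'\in\mathcal S(K)}\mathcal N_{K'}$ has at least $N_m$ nodes. $\mathcal D(K)$ is the interior of $\bigcup_{K'\in\mathcal S(K)}\overline{K'}$. $\mathcal P_m(D)$ is the space of polynomials of degree at most $m$ on $D$. Standing assumption: for every $K$ and $p\in\mathcal P_m(\mathcal D(K))$,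 $p|_{\mathcal I(K)}=0$ implies $p=0$ on $\mathcal D(K)$. Reconstruction. $V_h=\{v_h\in H^1(\Omega):v_h|_K\in\mathcal P_1(K)\ \forall K\in\mathcal T_h\}$ is the continuous piecewise linear space. For $v_h\in V_h$, $\mathcal R_K^mv_h\in\mathcal P_m(\mathcal D(K))$ is the unique minimizer of $\sum_{\boldsymbol x\in\mathcal I(K)}|p(\boldsymbol x)-v_h(\boldsymbol x)|^2$ over $p\in\mathcal P_m(\mathcal D(K))$ subject to $p(\boldsymbol y)=v_h(\boldsymbol y)$ for all $\boldsymbol y\in\mathcal N_K$. It depends linearly on $v_h$. $\mathcal R^mv_h$ is the piecewise polynomial function with $(\mathcal R^mv_h)|_K=(\mathcal R_K^mv_h)|_K$ for every $K\in\mathcal T_h$, and $\mathcal V_h^m:=\mathcal R^mV_h$ is its image space. *)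

(* Defs.v *)
From HB Require Import structures.
From mathcomp Require Import all_boot all_order all_algebra.
From mathcomp Require Import all_classical all_reals all_analysis.
From mathcomp Require mpoly.
(* mpoly's notations clash with those of MathComp-Analysis. *)
Export -(notations) mpoly.

Set Implicit Arguments.
Unset Strict Implicit.
Unset Printing Implicit Defensive.

Import Order.TTheory GRing.Theory Num.Theory.
Import numFieldNormedType.Exports.

Local Open Scope classical_set_scope.
Local Open Scope ring_scope.

Section Geometry.
Context {R : realType} {d : nat}.
Implicit Types x y : 'rV[R]_d.

(* The topology of 'rV[R]_d comes from the sup norm; metric quantities below
   use the Euclidean distance. *)
Definition edist x y : R := Num.sqrt (\sum_i (x 0 i - y 0 i) ^+ 2).

Definition polyhedron (A : set 'rV[R]_d) : Prop :=
  exists k (M : 'M[R]_(k, d)) (b : 'cV[R]_k),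
    A = [set x | forall i, (M *m x^T) i 0 <= b i 0].

Definition convex_polytopal_domain (Omega : set 'rV[R]_d) : Prop :=
  [/\ open Omega, Omega !=set0, bounded_set Omega, convex_set Omega
    & polyhedron (closure Omega)].

Definition diam (A : set 'rV[R]_d) : R :=
  sup [set r | exists x y, [/\ A x, A y & r = edist x y]].

Definition inradius (A : set 'rV[R]_d) : R :=
  sup [set r | 0 <= r /\ exists x, [set y | edist x y <= r] `<=` A].

Definition peval (p : mpoly d R) x : R := meval (fun i => x 0 i) p.

Definition degree_le (m : nat) (p : mpoly d R) : bool := (msize p <= m.+1)%N.

End Geometry.

(* An element is encoded by its set of vertices. *)
Record mesh (R : realType) (d : nat) := Mesh {
  node : finType;
  coord : node -> 'rV[R]_d;
  elts : {set {set node}} }.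

Section Mesh.
Context {R : realType} {d : nat} (T : mesh R d).
Implicit Types (K A : {set node T}) (S : {set {set node T}}).

Definition hull A : set 'rV[R]_d :=
  [set x | exists c : node T -> R,
    [/\ forall a, a \in A -> 0 <= c a, \sum_(a in A) c a = 1
      & x = \sum_(a in A) c a *: coord a]].

Definition affinely_independent A : Prop :=
  forall c : node T -> R,
    \sum_(a in A) c a = 0 -> \sum_(a in A) c a *: coord a = 0 ->
    forall a, a \in A -> c a = 0.

(* Elements are closed nondegenerate simplices; any two of them meet exactly
   in their common face (hull finset.set0 is empty). *)
Definition triangulation (Omega : set 'rV[R]_d) : Prop :=
  [/\ injective (@coord R d T),
      forall a, exists2 K, K \in elts T & a \in K,
      forall K, K \in elts T -> #|K| = d.+1 /\ affinely_independent K,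
      forall K K', K \in elts T -> K' \in elts T ->
        hull K `&` hull K' = hull (K :&: K')
    & closure Omega = \bigcup_(K in [set` elts T]) hull K].

(* max_K h_K <= nu * min_K rho_K *)
Definition quasi_uniform (nu : R) : Prop :=
  forall K K', K \in elts T -> K' \in elts T ->
    diam (hull K) <= nu * inradius (hull K').

Definition neighbours K : {set {set node T}} :=
  [set K' in elts T | `[< hull K `&` hull K' !=set0 >]]%SET.

Fixpoint layers (t : nat) K : {set {set node T}} :=
  if t is t'.+1 then (\bigcup_(K' in layers t' K) neighbours K')%SET
  else [set K]%SET.

Definition nodes_of S : {set node T} := (\bigcup_(K in S) K)%SET.

Definition barycenter K : 'rV[R]_d := #|K|%:R^-1 *: \sum_(a in K) coord a.

(* Ties between equidistant elements may be broken arbitrarily, so this is a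
   relation: s is any admissible ordering of the outermost layer, of which the
   patch takes the shortest sufficient prefix. *)
Definition is_patch (Nm : nat) K S : Prop :=
  exists (t : nat) (s : seq {set node T}) (j : nat),
    let part i := layers t.-1 K :|: [set:: take i s]%SET in
    [/\ [/\ (1 <= t)%N, (Nm <= #|nodes_of (layers t K)|)%N
          & forall t', (1 <= t' < t)%N -> (#|nodes_of (layers t' K)| < Nm)%N],
        perm_eq s (enum (layers t K :\: layers t.-1 K)),
        sorted (fun K1 K2 => edist (barycenter K1) (barycenter K)
                          <= edist (barycenter K2) (barycenter K)) s
      & [/\ (j <= size s)%N, S = part j, (Nm <= #|nodes_of S|)%N
          & forall i, (i < j)%N -> (#|nodes_of (part i)| < Nm)%N]].

Definition patch_domain S : set 'rV[R]_d :=
  (\bigcup_(K in [set` S]) hull K)°.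

Definition unisolvent (m : nat) S : Prop :=
  forall p : mpoly d R, degree_le m p ->
    (forall a, a \in nodes_of S -> peval p (coord a) = 0) ->
    forall x, patch_domain S x -> peval p x = 0.

(* An H^1 function that is affine on every element has a unique representative
   continuous on the closure of Omega, whose nodal values are meaningful; it is
   extended by zero outside so that equality in V_h is equality of functions. *)
Definition Vh (Omega : set 'rV[R]_d) : set ('rV[R]_d -> R^o) :=
  [set v | [/\ {within closure Omega, continuous v},
      forall K, K \in elts T ->
        exists2 p : mpoly d R, degree_le 1 p &
          forall x, hull K x -> v x = peval p x
    & forall x, ~ closure Omega x -> v x = 0]].

Definition least_squares S (v : 'rV[R]_d -> R^o) (p : mpoly d R) : R :=
  \sum_(a in nodes_of S) `|peval p (coord a) - v (coord a)| ^+ 2.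

Definition admissible (m : nat) K (v : 'rV[R]_d -> R^o) : set (mpoly d R) :=
  [set p | degree_le m p /\
           forall a, a \in K -> peval p (coord a) = v (coord a)].

(* A polynomial on the patch domain is represented by the formal polynomial,
   which it determines since that domain is a nonempty open set. *)
Definition local_rec (m : nat) (S : {set node T} -> {set {set node T}}) K
    (v : 'rV[R]_d -> R^o) : mpoly d R :=
  xget 0 [set p | admissible m K v p /\
    forall q, admissible m K v q ->
      least_squares (S K) v p <= least_squares (S K) v q].

(* The pieces need not agree on the mesh skeleton, a null set on which the
   value is set to 0; at most one summand is present. *)
Definition reconstruction (m : nat) (S : {set node T} -> {set {set node T}})
    (v : 'rV[R]_d -> R^o) : 'rV[R]_d -> R^o :=
  fun x => \sum_(K in elts T | x \in ((hull K)° : set _)) peval (local_rec m S K v) x.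

End Mesh.

(* A is a linear subspace of dimension n. *)
Definition has_dim (R : realType) (V : lmodType R) (A : set V) (n : nat) : Prop :=
  exists e : 'I_n -> V,
    (forall c : 'I_n -> R, \sum_i c i *: e i = 0 -> forall i, c i = 0) /\
    A = [set v | exists c : 'I_n -> R, v = \sum_i c i *: e i].

(* Main.v *)
Require Import Defs.
From mathcomp Require Import all_boot all_order all_algebra.
From mathcomp Require Import all_classical all_reals all_analysis.
From mathcomp Require Import ring lra.
Set Implicit Arguments.
Unset Strict Implicit.
Unset Printing Implicit Defensive.

Import Order.TTheory GRing.Theory Num.Theory.
Import numFieldNormedType.Exports.
Local Open Scope classical_set_scope.
Local Open Scope ring_scope.

(** The local reconstruction interpolates [v] at the vertices of its element.
    So if the reconstruction of [v] vanishes, then on each element [K] a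
    polynomial vanishes on the interior of [K], hence, by continuity, at the
    vertices of [K], where it takes the nodal values of [v]. All nodal values
    of [v] are therefore zero, and a continuous piecewise affine function is
    determined by its nodal values ([reconstruction_nondegenerate]). The
    dimensions then agree because an injective linear map sends a basis of
    [Vh] to a basis of the image.

    Linearity has to be extracted from a definition that picks some minimizer.
    The constrained minimizers are exactly the admissible polynomials whose
    residual at the patch nodes is orthogonal to every polynomial vanishing at
    the vertices of [K] ([local_rec_normal]). These normal equations are linear
    in the pair (data, polynomial). A solution exists by orthogonal projection
    in the space of nodal values. Two solutions for the same data have the same
    values at the patch nodes, hence, by unisolvence, the same values on the
    patch domain, which contains the interior of [K]
    ([normal_equations_unique]).

    The geometry enters through two facts on simplices: a point with positive
    barycentric coordinates is interior ([interior_of_positive_coordinates]),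
    which makes every vertex a limit of interior points, and a proper face has
    empty interior ([interior_of_face]), so that at most one element
    contributes to the reconstruction at any given point. *)

(* Here [coord] is the position of a mesh node, rather than a coordinate in a
   basis of a vector space. *)
Local Notation coord := Defs.coord.

(** * Subspaces, bases and orthogonal projection *)

Definition linear_subspace {R : fieldType} {V : lmodType R} (A : set V) : Prop :=
  A 0 /\ forall (a : R) u v, A u -> A v -> A (a *: u + v).

Definition linear_on {R : fieldType} {V W : lmodType R} (A : set V) (L : V -> W)
    : Prop :=
  forall (a : R) u v, A u -> A v -> L (a *: u + v) = a *: L u + L v.

Lemma linear_subspace_sum (R : fieldType) (V : lmodType R) (A : set V)
    (I : finType) (c : I -> R) (e : I -> V) :
  linear_subspace A -> (forall i, A (e i)) -> A (\sum_i c i *: e i).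
Proof.
move=> [A0 AD] Ae; elim/big_ind: _ => // [u v Au Av|i _].
  by rewrite -[u]scale1r; exact: AD.
by rewrite -[_ *: _]addr0; exact: AD.
Qed.

Lemma linear_on0 (R : fieldType) (V W : lmodType R) (A : set V) (L : V -> W) :
  A 0 -> linear_on A L -> L 0 = 0.
Proof.
move=> A0 LD; have := LD 1 0 0 A0 A0; rewrite !scale1r addr0.
by move/eqP; rewrite -subr_eq0 opprD addNKr oppr_eq0 => /eqP.
Qed.

Lemma linear_on_sum (R : fieldType) (V W : lmodType R) (A : set V) (L : V -> W)
    (I : finType) (c : I -> R) (e : I -> V) :
  linear_subspace A -> linear_on A L -> (forall i, A (e i)) ->
  L (\sum_i c i *: e i) = \sum_i c i *: L (e i).
Proof.
move=> [A0 AD] LD Ae.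
have L0 := linear_on0 A0 LD.
have Lsum r : L (\sum_(i <- r) c i *: e i) = \sum_(i <- r) c i *: L (e i)
    /\ A (\sum_(i <- r) c i *: e i).
  elim: r => [|i r [IH Ar]]; first by rewrite !big_nil.
  by rewrite !big_cons LD // IH; split=> //; exact: AD.
by have [] := Lsum (index_enum I).
Qed.

(** A free family of vectors of [W] with the largest possible size spans [W];
    the size of free families is bounded by [n]. *)
Lemma row_basis (F : fieldType) (n : nat) (W : set 'rV[F]_n) :
  linear_subspace W ->
  exists r (B : 'M[F]_(r, n)), row_free B /\ forall u, W u <-> (u <= B)%MS.
Proof.
move=> [W0 WD].
pose P k := `[< exists B : 'M[F]_(k, n), row_free B /\ forall i, W (row i B) >].
have P0 : exists k, P k.
  exists 0%N; apply/asboolP; exists 0; split; last by case.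
  by rewrite -row_leq_rank.
have Pn k : P k -> (k <= n)%N.
  by move=> /asboolP[B [/eqP Bk _]]; rewrite -Bk; exact: rank_leq_col.
case: (ex_maxnP P0 Pn) => k /asboolP[B [Bfree BW]] kmax.
exists k, B; split=> // u; split=> [Wu|/submxP[c ->]].
- apply/contraT => uB.
  suff /kmax : P (k + 1)%N by rewrite addn1 ltnn.
  apply/asboolP; exists (col_mx B u); split.
    have /rank_ltmx : (B < B + u)%MS.
      by rewrite ltmxE addsmxSl addsmx_sub submx_refl.
    by rewrite addsmxE (eqP Bfree) -row_leq_rank => kr; apply: leq_trans kr; rewrite addn1.
  move=> i; rewrite -(fintype.splitK i); case: (fintype.split i) => j /=.
    by rewrite rowKu.
  by rewrite rowKd row_id.
- by rewrite mulmx_sum_row; apply: linear_subspace_sum.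
Qed.

(** If [x *m (B *m B^T) = 0] then [x *m B] has zero sum of squares. *)
Lemma gram_unitmx (R : realFieldType) (r n : nat) (B : 'M[R]_(r, n)) :
  row_free B -> B *m B^T \in unitmx.
Proof.
move=> Bfree; rewrite -row_free_unit; apply: inj_row_free => x xG.
apply: (row_free_inj Bfree); rewrite mul0mx.
have : ((x *m B) *m (x *m B)^T) 0 0 = 0.
  by rewrite trmx_mul mulmxA -(mulmxA x) xG mul0mx mxE.
move: (x *m B) => y; rewrite mxE => /eqP; rewrite psumr_eq0; last first.
  by move=> i _; rewrite mxE -expr2 sqr_ge0.
move=> /allP y0; apply/rowP => i; have := y0 i (mem_index_enum i).
by rewrite !mxE mulf_eq0 orbb => /eqP.
Qed.

(** With [B] the matrix of a basis of [W], the projection of [f] is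
    [f *m B^T *m invmx (B *m B^T) *m B]. Only the values on [A] matter, so the
    computation takes place in the row space indexed by [A]. *)
Lemma orthogonal_projection (R : realFieldType) (I : finType) (A : {set I})
    (W : set (I -> R^o)) (f : I -> R^o) :
  linear_subspace W ->
  exists2 g, W g & forall h, W h -> \sum_(a in A) (g a - f a) * h a = 0.
Proof.
move=> [W0 WD].
pose row_of (h : I -> R^o) : 'rV[R]_#|A| := \row_i h (enum_val i).
have [|r [B [Bfree BW]]] := @row_basis _ _ (row_of @` W).
  split; first by exists 0 => //; apply/rowP => i; rewrite !mxE.
  move=> a _ _ [u Wu <-] [v Wv <-]; exists (a *: u + v); first exact: WD.
  by apply/rowP => i; rewrite !mxE.
pose w := row_of f *m B^T *m invmx (B *m B^T) *m B.
have /BW [g Wg gw] : (w <= B)%MS by exact: submxMl.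
exists g => // h Wh.
have /submxP [c hc] : (row_of h <= B)%MS by apply/BW; exists h.
have : ((w - row_of f) *m (row_of h)^T) 0 0 = 0.
  rewrite hc trmx_mul mulmxA mulmxBl /w -!mulmxA mulVmx ?gram_unitmx //.
  by rewrite mulmx1 subrr mul0mx mxE.
rewrite -gw big_enum_val => wh0; rewrite -[RHS]wh0 mxE.
by apply: eq_bigr => i _; rewrite !mxE.
Qed.

(** Finite-dimensionality for a subspace of an arbitrary, possibly
    infinite-dimensional, space: lift a basis of its image under an injective
    linear map to row vectors. *)
Lemma has_dim_subspace (R : realType) (V : lmodType R) (A : set V) (N : nat)
    (E : V -> 'rV[R]_N) :
  linear_subspace A -> linear_on A E -> (forall v, A v -> E v = 0 -> v = 0) ->
  exists n, has_dim A n.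
Proof.
move=> Asub ED Einj; have [A0 AD] := Asub.
have [|n [B [Bfree BE]]] := @row_basis _ _ (E @` A).
  split; first by exists 0 => //; exact: linear_on0 ED.
  move=> a _ _ [u Au <-] [v Av <-].
  by exists (a *: u + v); [exact: AD | exact: ED].
have /choice [e eP] : forall i, exists v, A v /\ E v = row i B.
  by move=> i; have /BE[v Av vE] := row_sub i B; exists v.
have Ae i : A (e i) by have [] := eP i.
have Esum c : E (\sum_i c i *: e i) = (\row_i c i) *m B.
  rewrite (linear_on_sum _ Asub ED) // mulmx_sum_row.
  by apply: eq_bigr => i _; rewrite mxE; have [_ ->] := eP i.
exists n, e; split=> [c c0 i|].
  have : (\row_i c i) *m B = 0 *m B by rewrite -Esum c0 mul0mx (linear_on0 A0 ED).
  by move=> /(row_free_inj Bfree) /rowP /(_ i); rewrite !mxE.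
apply/seteqP; split=> [v Av|_ [c ->]]; last exact: linear_subspace_sum.
have /submxP[x vx] : (E v <= B)%MS by apply/BE; exists v.
exists (fun i => x 0 i); apply/eqP; rewrite -subr_eq0; apply/eqP.
set s := \sum_i _; have As : A s by exact: linear_subspace_sum.
have -> : v - s = (-1) *: s + v by rewrite scaleN1r addrC.
apply: Einj; first exact: AD.
rewrite ED // Esum vx.
have -> : \row_i x 0 i = x by apply/rowP => i; rewrite mxE.
by rewrite scaleN1r addNr.
Qed.

Lemma has_dim_image (R : realType) (V W : lmodType R) (A : set V) (L : V -> W)
    (n : nat) :
  linear_subspace A -> linear_on A L -> (forall v, A v -> L v = 0 -> v = 0) ->
  has_dim A n -> has_dim (L @` A) n.
Proof.
move=> Asub LD Linj [e [efree eA]].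
have Ae i : A (e i).
  rewrite eA; exists (fun j => (i == j)%:R).
  rewrite (bigD1 i) //= eqxx scale1r big1 ?addr0 // => j /negbTE ji.
  by rewrite eq_sym ji scale0r.
exists (L \o e); split=> [c c0 i|].
  apply: efree; apply: Linj; first exact: linear_subspace_sum.
  by rewrite (linear_on_sum _ Asub LD).
apply/seteqP; split=> [_ [v Av <-]|_ [c ->]] /=.
  move: Av; rewrite {1}eA => -[c ->]; exists c; exact: (linear_on_sum _ Asub LD).
exists (\sum_i c i *: e i); first exact: linear_subspace_sum.
exact: (linear_on_sum _ Asub LD).
Qed.

(** * Constrained least squares *)

Lemma peval_lin (R : realType) (d : nat) (a : R) (p q : mpoly d R) x :
  peval (a *: p + q) x = a * peval p x + peval q x.
Proof. by rewrite /peval mevalD mevalZ. Qed.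

Lemma peval0 (R : realType) (d : nat) (x : 'rV[R]_d) : peval 0 x = 0.
Proof. exact: meval0. Qed.

Lemma peval_sub (R : realType) (d : nat) (p q : mpoly d R) x :
  peval (p - q) x = peval p x - peval q x.
Proof. exact: mevalB. Qed.

Lemma degree_le_lin (R : realType) (d m : nat) (a : R) (p q : mpoly d R) :
  degree_le m p -> degree_le m q -> degree_le m (a *: p + q).
Proof.
rewrite /degree_le => pm qm; apply: leq_trans (msizeD_le _ _) _.
by rewrite geq_max qm andbT; apply: leq_trans (msizeZ_le _ _) _.
Qed.

Lemma degree_le0 (R : realType) (d m : nat) : @degree_le R d m 0.
Proof. by rewrite /degree_le msize0. Qed.

Section Reconstruction.
Context {R : realType} {d : nat} (T : mesh R d) (m : nat).
Implicit Types (K : {set node T}) (A : {set {set node T}}) (p q : mpoly d R).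

Lemma admissible_lin K (a : R) (u v : 'rV[R]_d -> R^o) p q :
  admissible m K u p -> admissible m K v q ->
  admissible m K (a *: u + v) (a *: p + q).
Proof.
move=> [pm pu] [qm qv]; split; first exact: degree_le_lin.
by move=> b bK; rewrite peval_lin pu // qv.
Qed.

(** First-order optimality conditions of the constrained problem; the test
    polynomials [q], admissible for zero data, are the admissible directions. *)
Definition normal_equations A K (v : 'rV[R]_d -> R^o) p : Prop :=
  admissible m K v p /\
  forall q, admissible m K 0 q ->
    \sum_(a in nodes_of A) (peval p (coord a) - v (coord a)) * peval q (coord a) = 0.

Lemma normal_equations_lin A K (c : R) (u v : 'rV[R]_d -> R^o) p q :
  normal_equations A K u p -> normal_equations A K v q ->
  normal_equations A K (c *: u + v) (c *: p + q).
Proof.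
move=> [pu pO] [qv qO]; split; first exact: admissible_lin.
move=> r r0.
transitivity (c * 0 + 0 : R); last by rewrite mulr0 addr0.
rewrite -[X in _ = c * X + _](pO r r0) -[X in _ = _ + X](qO r r0) mulr_sumr -big_split /=.
apply: eq_bigr => a _; rewrite peval_lin.
have -> : (c *: u + v) (coord a) = c * u (coord a) + v (coord a) by [].
ring.
Qed.

Lemma admissible_sub K (v : 'rV[R]_d -> R^o) p q :
  admissible m K v p -> admissible m K v q -> admissible m K 0 (q - p).
Proof.
move=> hp hq; have := admissible_lin (-1) hp hq.
by rewrite !scaleN1r addNr addrC.
Qed.

Lemma least_squares_pythagoras A K (v : 'rV[R]_d -> R^o) p q :
  normal_equations A K v p -> admissible m K v q ->
  least_squares A v q = least_squares A v p
    + \sum_(a in nodes_of A) (peval (q - p) (coord a)) ^+ 2.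
Proof.
move=> [pv pO] qv; have orth := pO _ (admissible_sub pv qv).
(* subtract twice the cross term, which is zero *)
rewrite /least_squares -[LHS](subr0 _) -[X in _ - X = _](mulr0 2).
rewrite -[X in _ - 2 * X = _]orth mulr_sumr -sumrB -big_split /=.
by apply: eq_bigr => a _; rewrite !real_normK ?num_real // peval_sub; ring.
Qed.

Lemma normal_equations_exist A K (v : 'rV[R]_d -> R^o) :
  (exists p, admissible m K v p) -> exists p, normal_equations A K v p.
Proof.
move=> [p pv].
pose values q : node T -> R^o := fun a => peval q (coord a).
have Wsub : linear_subspace (values @` admissible m K 0).
  split.
    exists 0; last by apply/funext => a; exact: peval0.
    by split=> [|a _]; [exact: degree_le0 | exact: peval0].
  move=> a _ _ [q q0 <-] [r r0 <-]; exists (a *: q + r).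
    by have := admissible_lin a q0 r0; rewrite scaler0 addr0.
  by apply/funext => b; rewrite /values peval_lin.
have [_ [q q0 <-] qO] := orthogonal_projection (nodes_of A)
  (fun a => v (coord a) - peval p (coord a)) Wsub.
exists (1 *: p + q); split.
  by have := admissible_lin 1 pv q0; rewrite scale1r addr0.
move=> r r0; have {}r0 : (values @` admissible m K 0) (values r) by exists r.
rewrite -[RHS](qO _ r0); apply: eq_bigr => a _.
by rewrite peval_lin /values; congr (_ * _); ring.
Qed.

(** By Pythagoras a solution of the normal equations is a minimizer, so the
    choice in [local_rec] does pick a minimizer. The same identity shows that
    any minimizer has the nodal values of that solution, hence satisfies the
    normal equations as well. *)
Lemma local_rec_normal (S : {set node T} -> {set {set node T}}) K
    (v : 'rV[R]_d -> R^o) :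
  (exists p, admissible m K v p) -> normal_equations (S K) K v (local_rec m S K v).
Proof.
move=> /(normal_equations_exist (S K)) [p pN]; have [pv pO] := pN.
rewrite /local_rec; case: xgetP => [q _ [qv qmin]|/(_ p) []]; last first.
  split=> // q qv; rewrite (least_squares_pythagoras pN qv) lerDl.
  by apply: sumr_ge0 => a _; exact: sqr_ge0.
split=> // r r0; rewrite -[RHS](pO r r0); apply: eq_bigr => a aA.
congr ((_ - _) * _).
have := qmin p pv; rewrite (least_squares_pythagoras pN qv) gerDl => le0.
have /eqP : \sum_(a in nodes_of (S K)) (peval (q - p) (coord a)) ^+ 2 = 0.
  by apply/eqP; rewrite eq_le le0 sumr_ge0 // => b _; exact: sqr_ge0.
rewrite psumr_eq0 => [/allP/(_ a (mem_index_enum a))|b _]; last exact: sqr_ge0.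
by rewrite aA /= sqrf_eq0 peval_sub subr_eq0 => /eqP.
Qed.

(** The difference of two solutions is itself an admissible test polynomial, so
    subtracting the two equations tested with it gives a zero sum of squares. *)
Lemma normal_equations_unique A K (v : 'rV[R]_d -> R^o) p q :
  unisolvent m A -> normal_equations A K v p -> normal_equations A K v q ->
  forall x, patch_domain A x -> peval p x = peval q x.
Proof.
move=> uni [pv pO] [qv qO] x Ax; apply/eqP; rewrite -subr_eq0 -peval_sub.
have adm0 := admissible_sub qv pv.
apply/eqP; apply: uni x Ax => [|a aA]; first by have [] := adm0.
have /eqP : \sum_(a in nodes_of A) (peval (p - q) (coord a)) ^+ 2 = 0.
  rewrite -[RHS](subr0 0) -[X in _ = X - _](pO _ adm0) -[X in _ = _ - X](qO _ adm0) -sumrB.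
  by apply: eq_bigr => b _; rewrite peval_sub; ring.
rewrite psumr_eq0 => [/allP/(_ a (mem_index_enum a))|b _]; last exact: sqr_ge0.
by rewrite aA /= sqrf_eq0 => /eqP.
Qed.

End Reconstruction.

(** * Simplices *)

Section Simplices.
Context {R : realType} {d : nat} (T : mesh R d).
Implicit Types (K A B : {set node T}) (p q : mpoly d R).

(** Any displacement [z] is realized by changing the barycentric coordinates by
    amounts controlled by the size of [z]: the square matrix with rows
    [(1, coord a)], for [a] in [K], is invertible by affine independence, and
    [C] is the sum of the absolute values of the entries of its inverse. *)
Lemma barycentric_displacement K :
  #|K| = d.+1 -> affinely_independent K ->
  exists2 C : R, 0 <= C & forall (z : 'rV[R]_d) (e : R), 0 <= e ->
    (forall j, `|z 0 j| <= e) -> exists mu : node T -> R,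
    [/\ \sum_(a in K) mu a = 0, \sum_(a in K) mu a *: coord a = z
      & forall a, a \in K -> `|mu a| <= C * e].
Proof.
move=> Kcard Kaff.
have [a0 a0K] : exists a, a \in K by apply/card_gt0P; rewrite Kcard.
pose rank a := enum_rank_in a0K a.
pose ones : 'M[R]_(#|K|, 1) := const_mx 1.
pose vertices : 'M[R]_(#|K|, d) := \matrix_i coord (enum_val i).
pose M := row_mx ones vertices.
have Msum (x : 'rV_#|K|) : x *m M =
    row_mx (\sum_(a in K) x 0 (rank a))%:M (\sum_(a in K) x 0 (rank a) *: coord a).
  rewrite mul_mx_row; congr row_mx.
    apply/rowP => i; rewrite ord1 !mxE eqxx mulr1n [RHS]big_enum_val /=.
    by apply: eq_bigr => j _; rewrite mxE mulr1 /rank enum_valK_in.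
  rewrite mulmx_sum_row [RHS]big_enum_val /=.
  by apply: eq_bigr => j _; rewrite rowK /rank enum_valK_in.
have Mfree : row_free M.
  apply: inj_row_free => x; rewrite Msum -row_mx0 => /eq_row_mx[x0 xc].
  apply/rowP => i; rewrite mxE -(enum_valK_in a0K i).
  apply: (Kaff (fun a => x 0 (rank a))) (enum_valP i) => //.
  by have /rowP/(_ 0) := x0; rewrite !mxE eqxx.
have Mfull : row_full M by rewrite /row_full (eqP Mfree) Kcard.
exists (\sum_k \sum_i `|pinvmx M k i|).
  by apply: sumr_ge0 => k _; apply: sumr_ge0.
move=> z e e0 ze; pose y : 'rV_(1 + d) := row_mx 0 z.
have ye k : `|y 0 k| <= e.
  by rewrite mxE; case: fintype.split => j; rewrite ?mxE ?normr0.
have := mulmxKpV (submx_full y Mfull); rewrite Msum.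
have -> : y = row_mx 0 z by []. 
move=> /eq_row_mx[x0 xz].
exists (fun a => (row_mx 0 z *m pinvmx M) 0 (rank a)); split=> // [|a aK].
  by have /rowP/(_ 0) := x0; rewrite !mxE eqxx.
rewrite mxE; apply: le_trans (ler_norm_sum _ _ _) _.
rewrite mulr_suml; apply: ler_sum => k _; rewrite normrM mulrC.
apply: ler_pM => //; rewrite (bigD1 (rank a)) //= lerDl.
by apply: sumr_ge0.
Qed.

Lemma interior_of_positive_coordinates K (c : node T -> R) :
  #|K| = d.+1 -> affinely_independent K ->
  (forall a, a \in K -> 0 < c a) -> \sum_(a in K) c a = 1 ->
  (hull K)° (\sum_(a in K) c a *: coord a).
Proof.
move=> Kcard Kaff c0 c1.
have [C C0 disp] := barycentric_displacement Kcard Kaff.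
pose eps : R := \big[Order.min/1]_(a in K) c a.
have eps0 : 0 < eps by apply: lt_bigmin.
pose e := eps / (C + 1).
have e0 : 0 < e by rewrite divr_gt0 // ltr_wpDl.
have Ce : C * e <= eps.
  rewrite /e mulrCA ger_pMr // ler_pdivrMr ?ltr_wpDl // mul1r.
  by rewrite lerDl.
apply/nbhs_ballP; exists e => //= y xy.
set x := \sum_(a in K) _ in xy.
have [j|mu [mu0 muz muC]] := disp (y - x) e (ltW e0).
  by have [_ /(_ 0 j)] := xy; rewrite !mxE distrC => /ltW.
exists (fun a => c a + mu a); split.
- move=> a aK; have := le_trans (muC a aK) Ce.
  have : eps <= c a by exact: bigmin_le_cond.
  by rewrite ler_norml => ? /andP[? _]; lra.
- by rewrite big_split /= c1 mu0 addr0.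
- under eq_bigr do rewrite scalerDl.
  by rewrite big_split /= muz -/x addrC subrK.
Qed.

Lemma vertex_in_hull K a : a \in K -> hull K (coord a).
Proof.
move=> aK; exists (fun b => (b == a)%:R); split=> [b _||]; first exact: ler0n.
  rewrite (bigD1 a) //= eqxx big1 ?addr0 // => b /andP[_ /negbTE ->] //.
rewrite (bigD1 a) //= eqxx scale1r big1 ?addr0 // => b /andP[_ /negbTE ->].
by rewrite scale0r.
Qed.

(** If [a] is a vertex of [K] outside [A], then moving slightly away from [a],
    to [x + t (x - a)], stays in [hull A]. The two expressions of this point
    form an affine relation between vertices of [K] in which [a] has the
    nonzero coefficient [- t]. *)
Lemma interior_of_face A K x :
  affinely_independent K -> A \subset K -> (hull A)° x -> A = K.
Proof.
move=> Kaff AK xint; apply/eqP; rewrite finset.eqEsubset AK /=; apply/fintype.subsetP => a aK.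
apply/contraT => aA.
have [c [_ c1 xc]] := interior_subset xint.
have line : x + t *: (x - coord a) @[t --> (0 : R)] --> x + 0 *: (x - coord a).
  by apply: cvgD; [exact: cvg_cst | apply: cvgZ; [exact: cvg_id | exact: cvg_cst]].
rewrite scale0r addr0 in line.
have near_hull : \forall t \near (0 : R)^'+, hull A (x + t *: (x - coord a)).
  exact: (cvg_at_right_filter line xint).
have [t [[c' [_ c'1 yc']] t0]] := filter_ex (filterI near_hull (nbhs_right_gt 0)).
have sumA (V : lmodType R) (F : node T -> V) :
    \sum_(b in K) (if b \in A then F b else 0) = \sum_(b in A) F b.
  rewrite -big_mkcondr; apply: eq_bigl => b /=.
  by case: (boolP (b \in A)) => [/(fintype.subsetP AK) ->|]; rewrite ?andbF.
have suma (V : lmodType R) (F : node T -> V) :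
    \sum_(b in K) (if b == a then F b else 0) = F a.
  rewrite (bigD1 a) //= eqxx big1 ?addr0 // => b /andP[_ /negbTE ->] //.
(* the relation (1 + t) x - (x + t (x - a)) - t a = 0, with the first two
   points expanded over the vertices of A *)
pose k b : R := (if b \in A then (1 + t) * c b - c' b else 0) - (if b == a then t else 0).
suff : k a = 0.
  by rewrite /k (negbTE aA) eqxx sub0r => /eqP; rewrite oppr_eq0 gt_eqF.
apply: Kaff aK.
  rewrite sumrB (sumA R^o) (suma R^o) sumrB -mulr_sumr c1 c'1.
  by ring.
have kE b : k b *: coord b =
    (if b \in A then ((1 + t) * c b - c' b) *: coord b else 0)
    - (if b == a then t *: coord b else 0).
  by rewrite /k scalerBl; case: ifP => _; case: ifP => _; rewrite ?scale0r.
under eq_bigr do rewrite kE.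
rewrite sumrB sumA suma.
under eq_bigr do rewrite scalerBl -scalerA.
rewrite sumrB -scaler_sumr -xc -yc'.
by apply/rowP => j; rewrite !mxE; ring.
Qed.

(** By linearity it is enough to treat monomials of degree at most one, which
    are [1] and the coordinate functions. *)
Lemma affine_combination_peval A p (c : node T -> R) :
  degree_le 1 p -> \sum_(a in A) c a = 1 ->
  peval p (\sum_(a in A) c a *: coord a) = \sum_(a in A) c a * peval p (coord a).
Proof.
move=> p1 c1; rewrite /peval [in LHS]mevalE.
under [RHS]eq_bigr do rewrite mevalE mulr_sumr.
rewrite exchange_big /= !big_seq; apply: eq_bigr => k kp.
under [RHS]eq_bigr do rewrite mulrCA.
rewrite -mulr_sumr; congr (_ * _).
have := leq_trans (msize_mdeg_lt kp) p1; rewrite ltnS leq_eqVlt ltnS leqn0.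
case/orP => [/mdeg1P[i /eqP ->]|]; last first.
  have mon0 (f : 'I_d -> R) : \prod_j f j ^+ mnm0 j = 1.
    by apply: big1 => j _; rewrite mnm0E.
  rewrite mdeg_eq0 => /eqP ->; rewrite mon0 -[LHS]c1.
  by apply: eq_bigr => a _; rewrite mon0 mulr1.
have mon (f : 'I_d -> R) : \prod_j f j ^+ (mnm1 i) j = f i.
  by rewrite -(mevalXU f i) mevalX.
rewrite mon summxE; apply: eq_bigr => a _.
by rewrite mon mxE.
Qed.

Lemma peval_along_line p (x v : 'rV[R]_d) :
  exists q : {poly R}, forall t, q.[t] = peval p (x + t *: v).
Proof.
exists (\sum_(k <- msupp p) mcoeff k p *: \prod_i ((x 0 i)%:P + v 0 i *: 'X) ^+ k i).
move=> t; rewrite /peval mevalE horner_sum; apply: eq_bigr => k _.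
rewrite hornerZ horner_prod; congr (_ * _); apply: eq_bigr => i _.
by rewrite !hornerE !mxE mulrC.
Qed.

Lemma poly_eq0_of_small_roots (q : {poly R}) :
  (forall t, 0 < t <= 1 -> q.[t] = 0) -> q = 0.
Proof.
move=> q0; apply/eqP/contraT => qn0.
pose rs : seq R := mkseq (fun n => n.+1%:R^-1) (size q).
have /(max_poly_roots qn0) : all (root q) rs.
  apply/allP => _ /mapP[n _ ->]; apply/eqP/q0.
  by rewrite invr_gt0 ltr0Sn /= invf_le1 ?ltr0Sn // ler1n.
rewrite size_mkseq ltnn => -> //; apply: mkseq_uniq => i j /invr_inj.
by move=> /eqP; rewrite eqr_nat => /eqP[].
Qed.

(** Along the segment from the vertex [a] to the barycenter the polynomial is a
    univariate one. It vanishes for all parameters in [(0, 1]], where the points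
    are interior, hence identically, and in particular at [a]. *)
Lemma peval_vertex_of_interior K p :
  #|K| = d.+1 -> affinely_independent K ->
  (forall x, (hull K)° x -> peval p x = 0) ->
  forall a, a \in K -> peval p (coord a) = 0.
Proof.
move=> Kcard Kaff p0 a aK.
pose z := \sum_(b in K) d.+1%:R^-1 *: coord b.
have [q qE] := peval_along_line p (coord a) (z - coord a).
suff q0 : q = 0 by rewrite -[coord a]addr0 -(scale0r (z - coord a)) -qE q0 horner0.
apply: poly_eq0_of_small_roots => t /andP[t0 t1]; rewrite qE; apply: p0.
(* barycentric coordinates of the point of parameter t *)
pose c b : R := t * d.+1%:R^-1 + (if b == a then 1 - t else 0).
have ->: coord a + t *: (z - coord a) = \sum_(b in K) c b *: coord b.
  under eq_bigr do rewrite scalerDl -scalerA.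
  rewrite big_split /= -scaler_sumr -/z (bigD1 a) //= eqxx big1.
    by apply/rowP => j; rewrite !mxE; ring.
  by move=> b /andP[_ /negbTE ->]; rewrite scale0r.
apply: interior_of_positive_coordinates => // [b _|].
  rewrite ltr_pwDl ?mulr_gt0 ?invr_gt0 ?ltr0Sn //.
  by case: ifP => // _; rewrite subr_ge0.
rewrite big_split /= sumr_const Kcard (bigD1 a) //= eqxx big1.
  by rewrite -[X in X + _ = _]mulr_natr -mulrA mulVf ?pnatr_eq0 // mulr1 addr0 addrC subrK.
by move=> b /andP[_ /negbTE ->].
Qed.


End Simplices.

(** * The reconstruction operator *)

Section Mesh.
Context {R : realType} {d : nat} (T : mesh R d) (Omega : set 'rV[R]_d).
Context (meshT : triangulation T Omega).
Implicit Types (K : {set node T}) (v : 'rV[R]_d -> R^o).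

(** A common interior point is interior to the common face, which must then be
    all of both elements. *)
Lemma elements_nonoverlapping K K' x :
  K \in elts T -> K' \in elts T -> (hull K)° x -> (hull K')° x -> K = K'.
Proof.
have [_ _ simplex conforming _] := meshT => KT KT' xK xK'.
have [_ Kaff] := simplex K KT; have [_ Kaff'] := simplex K' KT'.
have xI : (hull (K :&: K'))° x by rewrite -conforming //; exact: filterI.
have KK : K :&: K' = K by apply: interior_of_face xI => //; exact: finset.subsetIl.
rewrite -[LHS]KK; apply: interior_of_face xI => //; exact: finset.subsetIr.
Qed.

Lemma reconstruction_on_element m S v K x :
  K \in elts T -> (hull K)° x ->
  reconstruction m S v x = peval (local_rec m S K v) x.
Proof.
move=> KT xK; rewrite /reconstruction (bigD1 K) /=; last by rewrite KT inE.
rewrite big1 ?addr0 // => K' /andP[/andP[KT' /set_mem xK']] /eqP[].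
exact: elements_nonoverlapping xK.
Qed.

Lemma element_in_layers K t : K \in elts T -> K \in layers t K.
Proof.
move=> KT; elim: t => [|t IH] /=; first exact: set11.
apply/bigcupP; exists K => //; rewrite inE KT; apply/asboolP.
have [_ _ /(_ K KT)[Kcard _] _ _] := meshT.
have [a aK] : exists a, a \in K by apply/card_gt0P; rewrite Kcard.
by exists (coord a); split; exact: vertex_in_hull.
Qed.

Lemma element_interior_in_patch Nm K A x :
  K \in elts T -> is_patch Nm K A -> (hull K)° x -> patch_domain A x.
Proof.
move=> KT [t [s [j [_ _ _ [_ AE _ _]]]]]; apply: interiorS => y yK.
by exists K => //=; rewrite AE inE element_in_layers.
Qed.

Lemma Vh_linear_subspace : linear_subspace (Vh T Omega).
Proof.
split.
  split=> // [|K KT].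
    by apply: continuous_subspaceT; exact: (@cst_continuous _ _ (0 : R^o)).
  by exists 0 => [|x _]; [exact: degree_le0 | rewrite peval0].
move=> c u v [ucont uaff u0] [vcont vaff v0]; split=> [|K KT|x xO].
- apply: within_continuousD => //.
  by move=> x; apply: cvgZ; [exact: cvg_cst | exact: ucont].
- have [p p1 up] := uaff K KT; have [q q1 vq] := vaff K KT.
  exists (c *: p + q); first exact: degree_le_lin.
  by move=> x xK; rewrite peval_lin -up // -vq.
- have -> : (c *: u + v) x = c * u x + v x by [].
  by rewrite u0 // v0 // mulr0 addr0.
Qed.

Lemma Vh_admissible m K v : (1 <= m)%N -> Vh T Omega v -> K \in elts T ->
  exists p, admissible m K v p.
Proof.
move=> m1 [_ vaff _] KT; have [p p1 vp] := vaff K KT; exists p; split.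
  exact: leq_trans p1 _.
by move=> a aK; rewrite vp //; exact: vertex_in_hull.
Qed.

Lemma Vh_eq0 v : Vh T Omega v -> (forall a : node T, v (coord a) = 0) -> v = 0.
Proof.
move=> [_ vaff v0] vn; apply/funext => x.
have [xO|/v0 //] := pselect (closure Omega x).
have [_ _ _ _ cover] := meshT; move: xO; rewrite cover => -[K KT xK].
have [p p1 vp] := vaff K KT; rewrite (vp _ xK).
have [c [_ c1 ->]] := xK; rewrite affine_combination_peval //.
by apply: big1 => a aK; rewrite -vp ?vn ?mulr0 //; exact: vertex_in_hull.
Qed.

Context (m Nm : nat) (S : {set node T} -> {set {set node T}}) (m1 : (1 <= m)%N).

Lemma reconstruction_linear :
  (forall K, K \in elts T -> is_patch Nm K (S K)) ->
  (forall K, K \in elts T -> unisolvent m (S K)) ->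
  linear_on (Vh T Omega) (reconstruction m S : _ -> ('rV[R]_d -> R^o)).
Proof.
move=> patch uni c u v uV vV; apply/funext => x.
have -> : (c *: reconstruction m S u + reconstruction m S v : 'rV[R]_d -> R^o) x
  = c * reconstruction m S u x + reconstruction m S v x by [].
rewrite /reconstruction mulr_sumr -big_split /=.
apply: eq_bigr => K /andP[KT /set_mem xK]; rewrite -peval_lin.
have adm w : Vh T Omega w -> normal_equations m (S K) K w (local_rec m S K w).
  by move=> wV; apply: local_rec_normal; exact: Vh_admissible.
have cV : Vh T Omega (c *: u + v) by have [_] := Vh_linear_subspace; exact.
apply: (normal_equations_unique (uni K KT) (adm _ cV)).
  exact: (normal_equations_lin c (adm _ uV) (adm _ vV)).
exact: element_interior_in_patch (patch K KT) xK.
Qed.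

Lemma reconstruction_nondegenerate v :
  Vh T Omega v -> reconstruction m S v = 0 -> v = 0.
Proof.
move=> vV rec0; apply: (Vh_eq0 vV) => a.
have [_ /(_ a)[K KT aK] /(_ K KT)[Kcard Kaff] _ _] := meshT.
have [[_ interp] _] := local_rec_normal S (Vh_admissible m1 vV KT).
rewrite -interp //; apply: peval_vertex_of_interior aK => // x xK.
by rewrite -(reconstruction_on_element m S v KT xK) rec0.
Qed.

Lemma Vh_has_dim : exists n, has_dim (Vh T Omega) n.
Proof.
pose nodal v : 'rV[R]_#|node T| := \row_i v (coord (enum_val i)).
apply: (has_dim_subspace (E := nodal)) Vh_linear_subspace _ _.
  by move=> c u v _ _; apply/rowP => i; rewrite !mxE.
move=> v vV nv0; apply: Vh_eq0 => // a.
by have /rowP/(_ (enum_rank a)) := nv0; rewrite !mxE enum_rankK.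
Qed.

End Mesh.

Theorem lemma2 (R : realType) (d m Nm : nat) (nu : R)
    (Omega : set 'rV[R]_d) (T : mesh R d)
    (S : {set node T} -> {set {set node T}})
    (hd : d = 2%N \/ d = 3%N) (hm : (1 <= m)%N) (hNm : (d.+1 < Nm)%N)
    (hOmega : convex_polytopal_domain Omega)
    (hT : triangulation T Omega) (hqu : quasi_uniform T nu)
    (hS : forall K, K \in elts T -> is_patch Nm K (S K))
    (huni : forall K, K \in elts T -> unisolvent m (S K)) :
  [/\ forall (a : R) (u v : 'rV[R]_d -> R^o), Vh T Omega u -> Vh T Omega v ->
        reconstruction m S (a *: u + v) = a *: reconstruction m S u + reconstruction m S v,
      forall v : 'rV[R]_d -> R^o, Vh T Omega v -> reconstruction m S v = 0 -> v = 0
    & exists n : nat,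
        has_dim (Vh T Omega) n /\ has_dim (reconstruction m S @` Vh T Omega) n].
Proof.
have linear := reconstruction_linear hT hm hS huni.
have nondegenerate := reconstruction_nondegenerate (S := S) hT hm.
split=> //; have [n Vdim] := Vh_has_dim hT; exists n; split=> //.
apply: has_dim_image linear _ Vdim => //; exact: (Vh_linear_subspace T Omega).
Qed.
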